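(* Let $n\ge 1$ and let $v=(v_0,v_1,\dots,v_n,v_{n+1})$ be a sequence of vectors in $\mathbb{R}^2$ with $v_0=\begin{pmatrix}0\\ 1\end{pmatrix}$, $v_i=\begin{pmatrix}a_i\\ b_i\end{pmatrix}$ for $1\le i\le n$, $v_{n+1}=\begin{pmatrix}1\\ 0\end{pmatrix}$, such that $\det(v_i,v_{i+1})\neq 0$ for every $i=0,\dots,n$. Let $A$ be the real symmetric $n\times n$ matrix whose $(i,j)$ entry is $a_ib_j$ for $i\le j$. Suppose that all $v_i$ lie on the upper half plane of $\mathbb{R}^2$. If the sequence $v=(v_0,v_1,\dots,v_{n+1})$ rotates counterclockwise around the origin up to $v_k$ for some $0\le k\le n$ and clockwise from $v_k$, then $\mathrm{Sign}(A)=n-2k$. In particular, $A$ is positive definite (i.e. $\mathrm{Sign}(A)=n$) if $v=(v_0,v_1,\dots,v_n,v_{n+1})$ rotates around the origin clockwise.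
   Context: For a real symmetric matrix $A$, $\mathrm{Sign}(A)$ is the number of positive eigenvalues minus the number of negative eigenvalues (counted with multiplicity). $\det(u,w)$ is the determinant of the $2\times2$ matrix with columns $u,w$. The upper half plane is $\{(x,y)^T: y\ge 0\}$ (it contains $v_{n+1}$). Each $v_i$ is understood to rotate toward $v_{i+1}$ through the angle of absolute value less than $\pi$; thus ''$v$ rotates counterclockwise up to $v_k$ and clockwise from $v_k$'' means $\det(v_i,v_{i+1})>0$ for $0\le i<k$ and $\det(v_i,v_{i+1})<0$ for $k\le i\le n$; ''$v$ rotates clockwise'' is the case $k=0$. *)

(* Defs.v *)
From mathcomp Require Import all_boot all_order all_algebra.
From mathcomp Require Import reals.
From mathcomp Require Import polyrcf.

Set Implicit Arguments.
Unset Strict Implicit.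
Unset Printing Implicit Defensive.

Import Order.TTheory GRing.Theory Num.Theory.
Local Open Scope ring_scope.

Definition vec2 (R : realType) (x y : R) : 'cV[R]_2 :=
  \col_(i < 2) (if i == 0 then x else y).

Definition det2 (R : realType) (u w : 'cV[R]_2) : R :=
  \det (row_mx u w : 'M[R]_2).

(* Multiplicities are algebraic: [mup x p] is the multiplicity of x as a root
   of p, and [rootsR p] lists the distinct real roots of p. *)
Definition num_pos_eig (R : realType) (n : nat) (A : 'M[R]_n) : nat :=
  (\sum_(x <- rootsR (char_poly A) | (0 < x)%R) mup x (char_poly A))%N.

Definition num_neg_eig (R : realType) (n : nat) (A : 'M[R]_n) : nat :=
  (\sum_(x <- rootsR (char_poly A) | (x < 0)%R) mup x (char_poly A))%N.

Definition Sign (R : realType) (n : nat) (A : 'M[R]_n) : int :=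
  (num_pos_eig A)%:Z - (num_neg_eig A)%:Z.

Definition posdef (R : realType) (n : nat) (A : 'M[R]_n) : Prop :=
  forall x : 'cV[R]_n, x != 0 -> 0 < (x^T *m A *m x) 0 0.

(* [v i] for i = 0, ..., n+1; the index i below ranges over 0, ..., n, so both
   [inord i] and [inord i.+1] are in range. *)
Definition step_det (R : realType) (n : nat) (v : 'I_n.+2 -> 'cV[R]_2)
    (i : 'I_n.+1) : R :=
  det2 (v (inord i)) (v (inord i.+1)).

Definition rotates_ccw_up_to (R : realType) (n : nat)
    (v : 'I_n.+2 -> 'cV[R]_2) (k : nat) : Prop :=
  forall i : 'I_n.+1, (i < k)%N -> 0 < step_det v i.

Definition rotates_cw_from (R : realType) (n : nat)
    (v : 'I_n.+2 -> 'cV[R]_2) (k : nat) : Prop :=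
  forall i : 'I_n.+1, (k <= i)%N -> step_det v i < 0.

Definition rotates_cw (R : realType) (n : nat)
    (v : 'I_n.+2 -> 'cV[R]_2) : Prop :=
  rotates_cw_from v 0.

Definition in_upper_half_plane (R : realType) (u : 'cV[R]_2) : Prop :=
  0 <= u 1 0.

(* Main.v *)
Require Import Defs.
From mathcomp Require Import all_boot all_order all_algebra.
From mathcomp Require Import spectral sesquilinear.
From mathcomp Require Import reals.
From mathcomp Require Import polyrcf complex.
From mathcomp Require Import ring lra.

(* Write q(x) = x A x^T and T_m = sum_(j > m) b_j x_j.  Summation by parts gives
   q(x) = sum_j a_j x_j (T_(j-1) + T_j), which equals
   sum_j (a_j / b_j) (T_(j-1)^2 - T_j^2) when no b_j vanishes.  The slopes
   a_j / b_j decrease while v turns counterclockwise and increase while it turns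
   clockwise, so q >= 0 on the subspace T_0 = ... = T_(k-1) = 0 of codimension
   at most k, and q <= 0 on the subspace x_(k+1) = ... = x_n = 0 of codimension
   n - k.  These two facts bound the numbers of negative and positive
   eigenvalues by k and n - k; since A is invertible, both are attained.  The only
   b_k that can vanish is the one at the turning point, and there the term
   a_k x_k (T_(k-1) + T_k) is zero on both subspaces. *)

Set Implicit Arguments.
Unset Strict Implicit.
Unset Printing Implicit Defensive.

Import Order.TTheory GRing.Theory Num.Theory.
Local Open Scope ring_scope.
Local Open Scope sesquilinear_scope.

Local Notation cmx := (map_mx (real_complex _)).

(** * Eigenvalue counts of a real symmetric matrix from its diagonalization *)

Lemma sum_count_mem (T : eqType) (P : pred T) (r s : seq T) :
  uniq r -> {subset s <= r} ->
  (\sum_(x <- r | P x) count_mem x s = count P s)%N.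
Proof.
move=> ur sr; elim: s sr => [|y s IHs] sr /=; first by rewrite big1.
rewrite big_split /= IHs; last by move=> x xs; apply: sr; rewrite inE xs orbT.
congr addn; rewrite -big_mkcondr /=.
rewrite sum1_count; case: (boolP (P y)) => [Py|nPy]; last first.
  apply/eqP; rewrite -leqn0 leqNgt -has_count; apply/hasPn => x _ /=.
  by apply: contra nPy => /andP[Px /eqP->].
rewrite (eq_count (a2 := pred1 y)).
  by rewrite count_uniq_mem // sr ?mem_head.
by move=> x /=; rewrite eq_sym; case: eqP => [->|]; rewrite ?Py ?andbF.
Qed.

Lemma num_eig_prod (R : realType) (P : pred R) (s : seq R)
  (p := \prod_(x <- s) ('X - x%:P)) :
  (\sum_(x <- rootsR p | P x) mup x p = count P s)%N.
Proof.
have p0 : p != 0 by rewrite monic_neq0 // monic_prod_XsubC.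
under eq_bigr do rewrite mu_prod_XsubC.
apply: sum_count_mem; first exact: uniq_roots.
by move=> x xs; rewrite -roots_on_rootsR // root_prod_XsubC.
Qed.

(** Over [R[i]] the matrix is Hermitian, so the complex spectral theorem applies and the eigenvalues
    are real: [d] is real while [P] stays complex. *)
Lemma real_symmetric_spectral (R : realType) (n : nat) (A : 'M[R]_n) :
  A^T = A ->
  exists (d : 'rV[R]_n) (P : 'M[R[i]]_n),
    P \is unitarymx /\ cmx A = P^t* *m diag_mx (cmx d) *m P.
Proof.
move=> Asym.
have Ah : cmx A \is hermsymmx.
  apply: realsym_hermsym.
    by apply/is_hermitianmxP; rewrite expr0 scale1r map_mx_id // map_trmx Asym.
  by apply/mxOverP => i j; rewrite !mxE complex_real.
have /mxOverP Dreal := hermitian_spectral_diag_real Ah.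
exists (map_mx (@complex.Re R) (spectral_diag (cmx A))), (spectralmx (cmx A)).
split; first exact: spectral_unitarymx.
rewrite -invmx_unitary ?spectral_unitarymx //.
have -> : cmx (map_mx (@complex.Re R) (spectral_diag (cmx A))) =
          spectral_diag (cmx A).
  by apply/matrixP => i j; rewrite !mxE RRe_real.
exact/orthomx_spectralP/hermitian_normalmx.
Qed.

Lemma char_poly_conj (F : fieldType) (n : nat) (P D : 'M[F]_n) :
  P \in unitmx -> char_poly (invmx P *m D *m P) = char_poly D.
Proof.
move=> Pu; rewrite /char_poly /char_poly_mx.
have fP : map_mx polyC P \in unitmx by rewrite map_unitmx.
have -> : 'X%:M - map_mx polyC (invmx P *m D *m P) =
    invmx (map_mx polyC P) *m ('X%:M - map_mx polyC D) *m map_mx polyC P.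
  by rewrite mulmxBr mulmxBl scalar_mxC mulmxKV // -map_invmx -!map_mxM.
by rewrite !det_mulmx mulrAC -det_mulmx mulVmx // det1 mul1r.
Qed.

Lemma char_poly_spectral (R : realType) (n : nat) (A : 'M[R]_n)
    (d : 'rV[R]_n) (P : 'M[R[i]]_n) :
  P \is unitarymx -> cmx A = P^t* *m diag_mx (cmx d) *m P ->
  char_poly A = \prod_(x <- [seq d 0 i | i <- enum 'I_n]) ('X - x%:P).
Proof.
move=> Pu Aeq; apply: (map_poly_inj (real_complex R)).
rewrite map_char_poly Aeq -invmx_unitary // char_poly_conj ?unitarymx_unit //.
rewrite char_poly_trig ?diag_mx_is_trig // big_map rmorph_prod big_enum /=.
apply: eq_bigr => i _.
by rewrite !mxE eqxx mulr1n rmorphB /= map_polyX map_polyC.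
Qed.

Lemma num_eig_spectral (R : realType) (Q : pred R) (n : nat) (A : 'M[R]_n)
    (d : 'rV[R]_n) (P : 'M[R[i]]_n) :
  P \is unitarymx -> cmx A = P^t* *m diag_mx (cmx d) *m P ->
  (\sum_(x <- rootsR (char_poly A) | Q x) mup x (char_poly A) =
   #|[pred i | Q (d ord0 i)]|)%N.
Proof.
move=> Pu Aeq; rewrite (char_poly_spectral Pu Aeq) num_eig_prod count_map.
by rewrite cardE [in RHS]/enum_mem size_filter enumT.
Qed.

(** * A dimension count bounding the negative eigenvalues *)

Lemma cmx_ReIm (R : realType) (m n : nat) (Z : 'M[R[i]]_(m, n)) :
  Z = cmx (map_mx (@complex.Re R) Z) + 'i%C *: cmx (map_mx (@complex.Im R) Z).
Proof. by apply/matrixP => i j; rewrite !mxE -complexE. Qed.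

Lemma cmx_ReIm_eq0 (R : realType) (m n : nat) (X Y : 'M[R]_(m, n)) :
  cmx X + 'i%C *: cmx Y = 0 -> X = 0 /\ Y = 0.
Proof.
move=> /matrixP XY; split; apply/matrixP => i j; have := XY i j;
  rewrite !mxE => /eqP; rewrite eq_complex /=; simpc => /andP[/eqP ? /eqP ?] //.
Qed.

(** The cross terms cancel by symmetry of [A]. This carries sign conditions on real vectors over to
    complex ones. *)
Lemma sesquiform_ReIm (R : realType) (n : nat) (A : 'M[R]_n) (x y : 'rV[R]_n)
    (z := cmx x + 'i%C *: cmx y) :
  A^T = A ->
  z *m cmx A *m z^t* = cmx (x *m A *m x^T + y *m A *m y^T).
Proof.
move=> Asym.
have zT : z^t* = cmx x^T - 'i%C *: cmx y^T.
  by apply/matrixP => i j; rewrite !mxE; simpc.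
have xy : y *m A *m x^T = x *m A *m y^T.
  have tr1 (M : 'M[R]_1) : M^T = M by apply/matrixP => i j; rewrite mxE !ord1.
  by rewrite -[LHS]tr1 !trmx_mul trmxK Asym mulmxA.
rewrite zT /z mulmxDl mulmxBr !mulmxDl -!scalemxAl -!scalemxAr -!map_mxM xy.
rewrite scalerA -expr2 sqr_i scaleN1r map_mxD.
by rewrite opprB addrACA subrr addr0.
Qed.

Lemma exists_left_kernel (F : fieldType) (m k : nat) (M : 'M[F]_(m, k)) :
  (k < m)%N -> exists2 u : 'rV_m, u != 0 & u *m M = 0.
Proof.
move=> km; have : kermx M != 0.
  rewrite -mxrank_eq0 mxrank_ker subn_eq0 -ltnNge.
  exact: leq_ltn_trans (rank_leq_col M) km.
by move=> /rowV0Pn[u /sub_kermxP uM u0]; exists u.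
Qed.

(** If more than [k] entries of [d] were negative, the span of their eigenvectors would meet the
    complex kernel of [B] in a nonzero vector, where the form would be both negative and
    nonnegative. *)
Lemma neg_spectrum_le (R : realType) (n k : nat) (A : 'M[R]_n)
    (d : 'rV[R]_n) (P : 'M[R[i]]_n) (B : 'M[R]_(n, k)) :
  A^T = A -> P \is unitarymx -> cmx A = P^t* *m diag_mx (cmx d) *m P ->
  (forall x : 'rV[R]_n, x *m B = 0 -> 0 <= (x *m A *m x^T) 0 0) ->
  (#|[pred i | (d ord0 i < 0)%R]| <= k)%N.
Proof.
move=> Asym Pu Aeq Bpos; rewrite leqNgt; apply/negP => km.
set m := #|_| in km; pose f : 'I_m -> 'I_n := enum_val.
have [u u0 uM] := exists_left_kernel (rowsub f P *m cmx B) km.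
(* [w] pads [u] with zeros off the negative eigenvalues; it lists the coordinates of [z] in the
   eigenbasis formed by the rows of [P]. *)
pose w := u *m rowsub f 1%:M; pose z := w *m P.
have wE j : w 0 j = \sum_i u 0 i * (f i == j)%:R.
  by rewrite mxE; apply: eq_bigr => i _; rewrite !mxE.
have wf i : w 0 (f i) = u 0 i.
  rewrite wE (bigD1 i) //= eqxx mulr1 big1 ?addr0 // => j ji.
  by rewrite (inj_eq enum_val_inj) (negPf ji) mulr0.
have w0 j : 0 <= d 0 j -> w 0 j = 0.
  move=> dj; rewrite wE big1 // => i _; case: eqP => [fij|]; rewrite ?mulr0 //.
  by have := enum_valP i; rewrite inE -/(f i) fij ltNge dj.
have zB : z *m cmx B = 0.
  by rewrite /z /w -[u *m _ *m P]mulmxA mul_rowsub_mx mul1mx -mulmxA.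
have zAz : (z *m cmx A *m z^t*) 0 0 = \sum_j (d 0 j)%:C%C * `|w 0 j| ^+ 2.
  rewrite Aeq /z trmx_mul map_mxM !mulmxA !mulmxtVK //.
  rewrite mul_mx_diag mxE; apply: eq_bigr => j _.
  by rewrite !mxE normCK mulrA [X in X * _]mulrC -!mulrA.
have neg : (z *m cmx A *m z^t*) 0 0 < 0.
  have [i ui] : exists i, u 0 i != 0.
    by apply/existsP; apply: contraNT u0 => /existsPn u0; apply/eqP/rowP => i;
       rewrite mxE; apply/eqP; move: (u0 i); rewrite negbK.
  have di : d 0 (f i) < 0 by have := enum_valP i; rewrite inE.
  have le0 j : (d 0 j)%:C%C * `|w 0 j| ^+ 2 <= 0.
    have [/w0->|dj] := leP 0 (d 0 j); first by rewrite normr0 expr0n mulr0.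
    by rewrite mulr_le0_ge0 ?exprn_ge0 // (lecR (d 0 j) 0) ltW.
  rewrite zAz (bigD1 (f i)) //= -[ltRHS]addr0 ltr_leD //; last exact: sumr_le0.
  by rewrite wf pmulr_llt0 ?exprn_gt0 ?normr_gt0 // (ltcR (d 0 (f i)) 0).
suff /le_lt_trans/(_ neg) : 0 <= (z *m cmx A *m z^t*) 0 0 by rewrite ltxx.
(* Since [B] is real, the real and imaginary parts of [z] lie separately in its kernel. *)
move: zB; rewrite (cmx_ReIm z) mulmxDl -scalemxAl -!map_mxM.
move=> /cmx_ReIm_eq0[/Bpos xB /Bpos yB].
rewrite sesquiform_ReIm // [X in _ <= X]mxE ler0c mxE.
exact: addr_ge0.
Qed.

(** * The quadratic form attached to a planar sequence *)

(* [(p i, q i)] is v_i for i = 0, ..., n+1, while [x i] (i = 0, ..., n-1) is the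
   variable paired with v_{i+1}. *)
Section PlanarSequence.
Variables (R : realFieldType) (n : nat) (p q x : nat -> R).

(** These sums express the row x A: its entry [j], counted from 0, is [q j.+1 * head_sum j.+1 + p
    j.+1 * tail_sum j.+1]. *)
Definition head_sum (m : nat) : R := \sum_(0 <= i < m) p i.+1 * x i.
Definition tail_sum (m : nat) : R := \sum_(m <= i < n) q i.+1 * x i.
Definition form_term (i : nat) : R :=
  p i.+1 * x i * (tail_sum i + tail_sum i.+1).

Local Notation S := head_sum.
Local Notation T := tail_sum.
Local Notation g := form_term.
(* Equal to 0 where [q i] vanishes. *)
Local Notation slope i := (p i / q i).

Lemma head_sum0 : S 0 = 0.
Proof. by rewrite /head_sum big_geq. Qed.

Lemma head_sumS m : S m.+1 = S m + p m.+1 * x m.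
Proof. by rewrite /head_sum big_nat_recr. Qed.

Lemma tail_sumS m : (m < n)%N -> T m = q m.+1 * x m + T m.+1.
Proof. by move=> mn; rewrite /tail_sum big_ltn. Qed.

Lemma tail_sum_end : T n = 0.
Proof. by rewrite /tail_sum big_geq. Qed.

Lemma form_termE m : (m < n)%N -> q m.+1 != 0 ->
  g m = slope m.+1 * (T m ^+ 2 - T m.+1 ^+ 2).
Proof. by move=> mn q0; rewrite /form_term tail_sumS //; field. Qed.

(* Summation by parts: the two sides differ by a telescoping sum of
   [S j * T j], and [S 0 = T n = 0]. *)
Lemma sum_form_term :
  \sum_(0 <= j < n) x j * (q j.+1 * S j.+1 + p j.+1 * T j.+1) =
  \sum_(0 <= j < n) g j.
Proof.
apply/eqP; rewrite -subr_eq0 -sumrB.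
rewrite (eq_big_nat _ _ (F2 := fun j => - (S j.+1 * T j.+1 - S j * T j))).
  rewrite sumrN telescope_sumr // tail_sum_end head_sum0.
  by rewrite mulr0 mul0r subrr oppr0.
by move=> j /andP[_ jn]; rewrite /form_term head_sumS (tail_sumS jn); ring.
Qed.

(** Rows [m - 1] and [m] give two linear equations for the pair [(S m, T m)], with the nonzero
    determinant of v_m and v_(m+1), so the pair vanishes. At the two ends the boundary values supply
    the missing equation. *)
Lemma form_nondegenerate :
  p 0 = 0 -> q n.+1 = 0 ->
  (forall i, (i <= n)%N -> p i * q i.+1 - p i.+1 * q i != 0) ->
  (forall j, (j < n)%N -> q j.+1 * S j.+1 + p j.+1 * T j.+1 = 0) ->
  forall i, (i < n)%N -> x i = 0.
Proof.
move=> p0 qn dn0 row0.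
have ST0 m : (m <= n)%N -> S m = 0 /\ T m = 0.
  move=> mn; have d0 := dn0 m mn.
  have e1 : q m * S m + p m * T m = 0.
    case: m mn {d0} => [|m] mn; last exact: row0.
    by rewrite head_sum0 p0 mulr0 mul0r addr0.
  have e2 : q m.+1 * S m + p m.+1 * T m = 0.
    move: mn; rewrite leq_eqVlt => /orP[/eqP->|mn].
      by rewrite qn tail_sum_end mulr0 mul0r addr0.
    by rewrite -(row0 m mn) head_sumS (tail_sumS mn); ring.
  split; apply: (mulfI d0); rewrite mulr0.
    have -> : 0 = p m * 0 - p m.+1 * 0 :> R by ring.
    by rewrite -{1}e2 -e1; ring.
  have -> : 0 = q m.+1 * 0 - q m * 0 :> R by ring.
  by rewrite -{1}e1 -e2; ring.
move=> i iin; have [Si Ti] := ST0 i (ltnW iin); have [Si1 Ti1] := ST0 i.+1 iin.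
have px : p i.+1 * x i = 0 by move: Si1; rewrite head_sumS Si add0r.
have qx : q i.+1 * x i = 0 by move: Ti; rewrite tail_sumS // Ti1 addr0.
apply: (mulfI (dn0 i (ltnW iin))).
have -> : (p i * q i.+1 - p i.+1 * q i) * x i =
          p i * (q i.+1 * x i) - q i * (p i.+1 * x i) by ring.
by rewrite px qx !mulr0 subrr.
Qed.

Variable k : nat.
Hypothesis kn : (k <= n)%N.
Hypotheses (p0 : p 0 = 0) (q0 : q 0 = 1).
Hypothesis q_ge0 : forall i, (i <= n.+1)%N -> 0 <= q i.
Hypothesis ccw : forall i, (i < k)%N -> 0 < p i * q i.+1 - p i.+1 * q i.
Hypothesis cw :
  forall i, (k <= i <= n)%N -> p i * q i.+1 - p i.+1 * q i < 0.

(** If v_i lay on the horizontal axis, then, its neighbours being in the upper half plane, the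
    determinants before and after it could not have the same strict sign; this is possible only at
    the turn [k]. *)
Lemma ordinate_gt0 i : (i <= n)%N -> i != k -> 0 < q i.
Proof.
move=> iin ik; rewrite lt0r q_ge0 ?(leq_trans iin) // andbT.
case: i iin ik => [|i] iin ik; first by rewrite q0 oner_eq0.
apply/eqP => qi.
have qi0 : 0 <= q i by rewrite q_ge0 // ltnW // ltnW.
have qi2 : 0 <= q i.+2 by rewrite q_ge0.
have [ltik|gtik|eik] := ltngtP i.+1 k; last by rewrite eik eqxx in ik.
  have := ccw ltik; have := ccw (ltnW ltik); rewrite qi => h1 h2.
    by have [ge0|lt0] := lerP 0 (p i.+1); nra.
have h1 : p i * q i.+1 - p i.+1 * q i < 0 by rewrite cw // -ltnS gtik ltnW.
have h2 : p i.+1 * q i.+2 - p i.+2 * q i.+1 < 0 by rewrite cw // ltnW.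
move: h1 h2; rewrite qi => h1 h2.
by have [ge0|lt0] := lerP 0 (p i.+1); nra.
Qed.

(** The slope is the cotangent of the angle of v_i, which decreases as the angle grows. The
    hypothesis on [q i.+1] guards the case [i.+1 = k], where the ordinate may vanish. *)
Lemma slope_decr i : (i < k)%N -> 0 < q i.+1 -> slope i.+1 <= slope i.
Proof.
move=> ik qi1; have qi : 0 < q i.
  by rewrite ordinate_gt0 ?(ltn_eqF ik) // (leq_trans (ltnW ik)).
rewrite ler_pdivrMr // mulrAC ler_pdivlMr //.
by rewrite -subr_ge0; apply/ltW/ccw.
Qed.

Lemma slope_incr i : (k <= i < n)%N -> 0 < q i -> slope i <= slope i.+1.
Proof.
move=> /andP[ki iin] qi; have qi1 : 0 < q i.+1.
  by rewrite ordinate_gt0 // gtn_eqF.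
rewrite ler_pdivrMr // mulrAC ler_pdivlMr // -subr_le0.
by apply/ltW/cw; rewrite ki ltnW.
Qed.

(** Abel summation: increasing slopes make every coefficient [slope m.+2 - slope m.+1] of
    [T m.+1 ^+ 2] nonnegative, and [T n = 0]. The length [r] allows induction from the end [n]
    downwards. *)
Lemma tail_form_ge r m : (m + r.+1)%N = n -> (k <= m)%N ->
  slope m.+1 * T m ^+ 2 <= \sum_(m <= i < n) g i.
Proof.
elim: r m => [|r IHr] m mr km.
all: have mn : (m < n)%N by rewrite -mr -addn1 leq_add2l.
all: have qm : 0 < q m.+1 by rewrite ordinate_gt0 // gtn_eqF.
all: rewrite big_ltn // form_termE ?gt_eqF //.
  have -> : m.+1 = n by rewrite -mr addn1.
  by rewrite big_geq // tail_sum_end expr0n subr0 addr0.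
have := IHr m.+1; rewrite addSnnS mr => /(_ erefl (leqW km)).
have : slope m.+1 <= slope m.+2.
  apply: slope_incr => //; rewrite leqW //= -mr -addSnnS addnS ltnS.
  exact: leq_addr.
by have := sqr_ge0 (T m.+1); nra.
Qed.

(** Splitting at [k], the head is at least [- slope k * T k ^+ 2] and the tail at least the opposite
    value. *)
Lemma form_ge0 : (forall m, (m < k)%N -> T m = 0) ->
  0 <= \sum_(0 <= i < n) g i.
Proof.
move=> Tk.
(* This covers the default value [slope k = 0]: both bounds below then reduce to 0. *)
have Tq : q k = 0 -> T k = 0.
  case: k kn Tk q0 => [|h] hn Th q00.
    by rewrite q00 => /eqP; rewrite oner_eq0.
  by move=> qh; have := Th h (ltnSn h); rewrite tail_sumS // qh mul0r add0r.
have head : - slope k * T k ^+ 2 <= \sum_(0 <= i < k) g i.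
  have kle := ordinate_gt0.
  case: k kn Tk Tq kle => [|h] hn Th Tq kle.
    by rewrite big_geq // p0 mul0r oppr0 mul0r.
  (* Consecutive vanishing tail sums give [x i = 0] for [i < h], so only the term of index [h]
     survives. *)
  rewrite big_nat_recr //= big_nat big1 ?add0r; last first.
    move=> i /andP[_ ih]; have qi : 0 < q i.+1.
      by apply: kle; rewrite ?(leq_trans (leqW ih)) // eqSS ltn_eqF.
    have : q i.+1 * x i = 0.
      have := Th i (ltnW ih); rewrite tail_sumS ?Th ?addr0 //.
      exact: leq_trans (leqW ih) hn.
    move=> /eqP; rewrite mulf_eq0 gt_eqF //= => /eqP xi.
    by rewrite /form_term xi mulr0 mul0r.
  have [qh|qh] := eqVneq (q h.+1) 0.
    by rewrite /form_term Tq // (Th h) // addr0 expr0n !mulr0.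
  by rewrite form_termE // (Th h) // expr0n sub0r mulrN mulNr.
have tail : slope k * T k ^+ 2 <= \sum_(k <= i < n) g i.
  move: (kn); rewrite leq_eqVlt => /orP[/eqP->|kltn].
    by rewrite tail_sum_end expr0n mulr0 big_geq.
  apply: le_trans (tail_form_ge (r := n - k.+1) _ (leqnn k)); last first.
    by rewrite -addSnnS subnKC.
  have [/Tq->|qk] := eqVneq (q k) 0; first by rewrite expr0n !mulr0.
  apply: ler_wpM2r; rewrite ?sqr_ge0 // slope_incr ?leqnn //.
  by rewrite lt0r qk q_ge0 // leqW.
by rewrite (big_cat_nat (leq0n k) kn) /=; lra.
Qed.

(** Mirror image of [tail_form_ge], with decreasing slopes and the starting value [slope 0 = 0]. It
    stops before [k], where the ordinate may vanish. *)
Lemma head_form_le m : (m < k)%N ->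
  \sum_(0 <= i < m) g i <= - slope m * T m ^+ 2.
Proof.
elim: m => [|m IHm] mk; first by rewrite big_geq // p0 mul0r oppr0 mul0r.
have mn : (m < n)%N by rewrite (leq_trans _ kn) // ltnW.
have qm : 0 < q m.+1 by rewrite ordinate_gt0 ?(ltn_eqF mk).
rewrite big_nat_recr //= form_termE ?gt_eqF //.
have := IHm (ltnW mk); have := slope_decr (ltnW mk) qm.
by have := sqr_ge0 (T m); nra.
Qed.

(** The terms from [k] on vanish, and so does [T k]. For [k > 0] and [q k > 0] the last remaining
    term, [slope k * T k.-1 ^+ 2], is absorbed by [head_form_le] at [k.-1], since
    [slope k <= slope k.-1]. *)
Lemma form_le0 : (forall i, (k <= i < n)%N -> x i = 0) ->
  \sum_(0 <= i < n) g i <= 0.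
Proof.
move=> xk.
have Tk : T k = 0.
  rewrite /tail_sum big_nat big1 // => i ikn; by rewrite xk // mulr0.
rewrite (big_cat_nat (leq0n k) kn) /= [X in _ + X]big_nat [X in _ + X]big1 ?addr0;
  last first.
  by move=> i ikn; rewrite /form_term xk // mulr0 mul0r.
move: slope_decr head_form_le q_ge0 kn Tk.
case: k => [|h] decr hle qge hn Th; first by rewrite big_geq.
rewrite big_nat_recr //=; have := hle h (ltnSn h).
have [qh|qh] := eqVneq (q h.+1) 0.
  have -> : T h = 0 by rewrite tail_sumS // qh mul0r add0r.
  by rewrite /form_term tail_sumS // qh mul0r Th !addr0 expr0n !mulr0 addr0.
have {}qh : 0 < q h.+1 by rewrite lt0r qh qge // leqW.
rewrite form_termE ?gt_eqF // Th expr0n subr0.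
by have := decr h (ltnSn h) qh; have := sqr_ge0 (T h); nra.
Qed.

End PlanarSequence.

(** * From semidefinite subspaces to signature and definiteness *)

(** [B] and [C] present the subspaces by equations, one per column, so their widths bound the
    codimensions and no rank is computed. *)
Lemma Sign_of_semidefinite_subspaces (R : realType) (n k : nat) (A : 'M[R]_n)
    (B : 'M[R]_(n, k)) (C : 'M[R]_(n, n - k)) :
  (k <= n)%N -> A^T = A ->
  (forall x : 'rV[R]_n, x *m A = 0 -> x = 0) ->
  (forall x : 'rV[R]_n, x *m B = 0 -> 0 <= (x *m A *m x^T) 0 0) ->
  (forall x : 'rV[R]_n, x *m C = 0 -> (x *m A *m x^T) 0 0 <= 0) ->
  Sign A = n%:Z - 2 * k%:Z.
Proof.
move=> kn Asym A0 Bpos Cneg.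
have [d [P [Pu Aeq]]] := real_symmetric_spectral Asym.
have d0 i : d 0 i != 0.
  apply/eqP => di0; have : root (char_poly A) 0.
    rewrite (char_poly_spectral Pu Aeq) root_prod_XsubC -di0.
    by rewrite map_f // mem_enum.
  rewrite -eigenvalue_root_char => /eigenvalueP[x]; rewrite scale0r.
  by move=> /A0-> /eqP.
rewrite /Sign /num_pos_eig /num_neg_eig !(num_eig_spectral _ Pu Aeq).
have neg_le := neg_spectrum_le Asym Pu Aeq Bpos.
have pos_le : (#|[pred i | (0 < d ord0 i)%R]| <= n - k)%N.
  have -> : #|[pred i | (0 < d ord0 i)%R]| = #|[pred i | ((- d) ord0 i < 0)%R]|.
    by apply: eq_card => i; rewrite !inE mxE oppr_lt0.
  (* Positive eigenvalues of [A] are negative ones of [- A], which the same [P] diagonalizes. *)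
  apply: (neg_spectrum_le (A := - A) (P := P) (B := C)) => //.
  - by rewrite raddfN /= Asym.
  - by rewrite !map_mxN linearN /= mulmxN mulNmx Aeq.
  - by move=> x /Cneg; rewrite mulmxN mulNmx [X in _ -> _ <= X]mxE oppr_ge0.
(* No eigenvalue is zero, so the counts add up to [n] and both upper bounds must be equalities. *)
have total : (#|[pred i | (0 < d ord0 i)%R]| +
              #|[pred i | (d ord0 i < 0)%R]| = n)%N.
  rewrite -[RHS]card_ord -(cardC [pred i | (0 < d ord0 i)%R]); congr addn.
  apply: eq_card => i; rewrite !inE -leNgt le_eqVlt.
  by rewrite (negPf (d0 i)).
have -> : #|[pred i | (0 < d ord0 i)%R]| = (n - k)%N.
  by apply/eqP; rewrite eqn_leq pos_le leq_subLR -{1}total addnC leq_add2r.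
have -> : #|[pred i | (d ord0 i < 0)%R]| = k.
  apply/eqP; rewrite eqn_leq neg_le -(leq_add2l (n - k)) subnK //.
  by rewrite -{1}total leq_add2r.
by rewrite -subzn //; ring.
Qed.

(** If the form vanishes at [u], its value at [u + t *: w] with [w = u *m A] is
    [2 * t * c + t ^+ 2 * m], where [c] is the squared norm of [w]. Nonnegativity for small negative
    [t] forces [c = 0], so [u] is in the kernel. *)
Lemma posdef_of_psd (R : realType) (n : nat) (A : 'M[R]_n) :
  A^T = A ->
  (forall x : 'rV[R]_n, x *m A = 0 -> x = 0) ->
  (forall x : 'rV[R]_n, 0 <= (x *m A *m x^T) 0 0) ->
  posdef A.
Proof.
move=> Asym A0 psd x x0; rewrite -[X in _ *m X]trmxK.
set u := x^T; have u0 : u != 0 by rewrite trmx_eq0.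
rewrite lt0r psd andbT; apply: contraNneq u0 => qu.
pose w := u *m A; pose c := (w *m w^T) 0 0; pose m := (w *m A *m w^T) 0 0.
have cE : c = \sum_j w 0 j ^+ 2.
  by rewrite /c mxE; apply: eq_bigr => j _; rewrite [w^T _ _]mxE expr2.
have line t : 0 <= 2 * t * c + t ^+ 2 * m.
  have := psd (u + t *: w).
  have wu : (w *m A *m u^T) 0 0 = c.
    have tr1 (M : 'M[R]_1) : M^T = M by apply/matrixP => i j; rewrite mxE !ord1.
    by rewrite /c -[w *m A *m _]tr1 !trmx_mul trmxK Asym mulmxA.
  rewrite linearD linearZ /= mulmxDl mulmxDr !mulmxDl -!scalemxAl -!scalemxAr.
  have addE (M N : 'M[R]_1) : (M + N) 0 0 = M 0 0 + N 0 0 by rewrite mxE.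
  have scaleE s (M : 'M[R]_1) : (s *: M) 0 0 = s * M 0 0 by rewrite mxE.
  rewrite !(addE, scaleE).
  rewrite qu wu -/c -/m add0r.
  lra.
have m0 : 0 <= m := psd w.
have c_ge0 : 0 <= c by rewrite cE sumr_ge0 // => j _; rewrite sqr_ge0.
have c0 : c = 0.
  apply/eqP; rewrite eq_le c_ge0 andbT leNgt; apply/negP => c_gt0.
  have m1 : m + 1 != 0 by rewrite gt_eqF // ltr_wpDl.
  (* The [+ 1] keeps the denominator positive even when [m = 0]. *)
  have := line (- c / (m + 1)).
  have -> : 2 * (- c / (m + 1)) * c + (- c / (m + 1)) ^+ 2 * m =
     - (c / (m + 1)) ^+ 2 * (m + 2) by field.
  rewrite mulNr oppr_ge0 leNgt; apply/negP; rewrite negbK.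
  by rewrite mulr_gt0 ?exprn_gt0 ?divr_gt0 ?ltr_wpDl.
apply/eqP/A0/rowP => j; rewrite [RHS]mxE.
apply/eqP; rewrite -sqrf_eq0; move/eqP: c0; rewrite cE.
by rewrite psumr_eq0 => [/allP/(_ j (mem_index_enum _))|i _]; rewrite ?sqr_ge0.
Qed.

(** * Planar determinants, and the passage from vectors to coordinate sequences *)

Lemma det_mx2 (R : comPzRingType) (M : 'M[R]_2) :
  \det M = M 0 0 * M 1 1 - M 0 1 * M 1 0.
Proof.
rewrite (expand_det_row _ 0) !big_ord_recl big_ord0 addr0 /cofactor.
rewrite !det_mx11 !mxE /= expr0 expr1 mul1r mulN1r mulrN.
by congr (M _ _ * M _ _ - M _ _ * M _ _); apply: val_inj.
Qed.

Lemma det2E (R : realType) (u w : 'cV[R]_2) :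
  det2 u w = u 0 0 * w 1 0 - w 0 0 * u 1 0.
Proof.
have colE0 i : row_mx u w i 0 = u i 0.
  by rewrite -(row_mxEl u w); congr (row_mx _ _ _ _); apply: val_inj.
have colE1 i : row_mx u w i 1 = w i 0.
  by rewrite -(row_mxEr u w); congr (row_mx _ _ _ _); apply: val_inj.
by rewrite /det2 det_mx2 !colE0 !colE1.
Qed.

(* a i, b i (i = 0, ..., n-1) are the coordinates of v_{i+1}. *)
Theorem corollary1p3 (R : realType) (n : nat) (hn : (1 <= n)%N)
    (v : 'I_n.+2 -> 'cV[R]_2) (a b : 'I_n -> R)
    (hv0 : v ord0 = vec2 0 1)
    (hv : forall i : 'I_n, v (inord i.+1) = vec2 (a i) (b i))
    (hvn1 : v ord_max = vec2 1 0)
    (hdet : forall i : 'I_n.+1, step_det v i != 0)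
    (A : 'M[R]_n)
    (hAsym : A^T = A)
    (hA : forall i j : 'I_n, (i <= j)%N -> A i j = a i * b j)
    (hup : forall i : 'I_n.+2, in_upper_half_plane (v i)) :
  (forall k : nat, (k <= n)%N ->
     rotates_ccw_up_to v k -> rotates_cw_from v k ->
     Sign A = n%:Z - 2 * k%:Z) /\
  (rotates_cw v -> posdef A /\ Sign A = n%:Z).
Proof.
(* Writing the size as a successor makes [inord] available on the indices of [A]. *)
case: n hn v a b hv0 hv hvn1 hdet A hAsym hA hup
  => // n _ v a b hv0 hv hvn1 hdet A hAsym hA hup.
pose p i := v (inord i) 0 0; pose q i := v (inord i) 1 0.
have i0 : inord 0 = ord0 :> 'I_n.+3 by apply: val_inj; rewrite /= inordK.
have in1 : inord n.+2 = ord_max :> 'I_n.+3 by apply: val_inj; rewrite /= inordK.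
have p0 : p 0 = 0 by rewrite /p i0 hv0 mxE.
have q0 : q 0 = 1 by rewrite /q i0 hv0 mxE.
have qn : q n.+2 = 0 by rewrite /q in1 hvn1 mxE.
have pE (i : 'I_n.+1) : p i.+1 = a i by rewrite /p hv mxE.
have qE (i : 'I_n.+1) : q i.+1 = b i by rewrite /q hv mxE.
have q_ge0 i : (i <= n.+2)%N -> 0 <= q i by move=> _; apply: hup.
have stepE i : (i <= n.+1)%N ->
    step_det v (inord i) = p i * q i.+1 - p i.+1 * q i.
  by move=> iin; rewrite /step_det det2E inordK.
have dn0 i : (i <= n.+1)%N -> p i * q i.+1 - p i.+1 * q i != 0.
  by move=> iin; rewrite -stepE.
pose ent (x : 'rV[R]_n.+1) i := x 0 (inord i).
have entE (x : 'rV[R]_n.+1) (i : 'I_n.+1) : ent x i = x 0 i.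
  by rewrite /ent inord_val.
have rowE (x : 'rV[R]_n.+1) (j : 'I_n.+1) :
    (x *m A) 0 j = q j.+1 * head_sum p (ent x) j.+1 +
                   p j.+1 * tail_sum n.+1 q (ent x) j.+1.
  rewrite /head_sum /tail_sum (big_nat_widen _ _ n.+1) ?ltn_ord //.
  rewrite (big_nat_widenl j.+1 0) // !big_mkord mxE.
  (* The column is cut at the diagonal; the part below it is read off through the symmetry of
     [A]. *)
  rewrite (bigID (fun i : 'I_n.+1 => i < j.+1)%N) /=.
  rewrite !big_distrr /=; congr (_ + _).
    by apply: eq_bigr => i ij; rewrite hA // pE qE entE; ring.
  apply: eq_big => [i|i ij]; first by rewrite -leqNgt.
  rewrite -hAsym mxE hA ?pE ?qE ?entE; first by ring.
  by rewrite ltnW // ltnNge.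
have formE (x : 'rV[R]_n.+1) :
    (x *m A *m x^T) 0 0 = \sum_(0 <= i < n.+1) form_term n.+1 p q (ent x) i.
  rewrite -sum_form_term big_mkord mxE; apply: eq_bigr => j _.
  by rewrite rowE entE [x^T _ _]mxE mulrC.
have nondeg (x : 'rV[R]_n.+1) : x *m A = 0 -> x = 0.
  move=> xA; apply/rowP => j; rewrite [RHS]mxE -entE.
  apply: (form_nondegenerate p0 qn dn0) => // i iin.
  by have := rowE x (Ordinal iin); rewrite xA mxE => <-.
have ccwE k : (k <= n.+1)%N -> rotates_ccw_up_to v k ->
    forall i, (i < k)%N -> 0 < p i * q i.+1 - p i.+1 * q i.
  move=> kn hk i ik; have iin : (i <= n.+1)%N by rewrite ltnW // (leq_trans ik).
  by rewrite -stepE // hk // inordK.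
have cwE k : rotates_cw_from v k ->
    forall i, (k <= i <= n.+1)%N -> p i * q i.+1 - p i.+1 * q i < 0.
  by move=> hk i /andP[ki iin]; rewrite -stepE // hk // inordK.
have signE k : (k <= n.+1)%N -> rotates_ccw_up_to v k -> rotates_cw_from v k ->
    Sign A = n.+1%:Z - 2 * k%:Z.
  move=> kn /(ccwE _ kn) hccw /cwE hcw.
  (* Column [m] of [B] computes the tail sum of index [m]; column [m] of [C] extracts the coordinate
     of index [m + k]. *)
  pose B : 'M[R]_(n.+1, k) := \matrix_(i, m) if (m <= i)%N then q i.+1 else 0.
  pose C : 'M[R]_(n.+1, n.+1 - k) := \matrix_(i, m) (i == (m + k)%N :> nat)%:R.
  apply: (Sign_of_semidefinite_subspaces (B := B) (C := C)) => // x xM.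
    rewrite formE; apply: (form_ge0 kn) => // m mk.
    have := congr1 (fun M : 'rV_k => M 0 (Ordinal mk)) xM.
    rewrite [RHS]mxE mxE => <-.
    rewrite /tail_sum (big_nat_widenl _ 0) // big_mkord big_mkcond.
    apply: eq_bigr => i _; rewrite mxE entE /=.
    by case: leqP => _; rewrite ?mulr0 // mulrC.
  rewrite formE; apply: (form_le0 kn) => // i /andP[ki iin].
  have ik : (i - k < n.+1 - k)%N by rewrite ltn_sub2r // (leq_ltn_trans ki).
  have := congr1 (fun M : 'rV_(n.+1 - k) => M 0 (Ordinal ik)) xM.
  rewrite [RHS]mxE mxE (bigD1 (Ordinal iin)) //= big1 ?addr0 => [|j ji].
    by rewrite mxE /= subnK // eqxx mulr1 -entE.
  rewrite mxE /= subnK //; case: eqP => [e|]; last by rewrite mulr0.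
  by case/eqP: ji; apply: val_inj.
split=> // hcw.
have hccw : rotates_ccw_up_to v 0 by [].
split; last by rewrite (signE 0) // mulr0 subr0.
(* For [k = 0] the condition on tail sums is vacuous, so the form is nonnegative on the whole
   space. *)
apply: posdef_of_psd => // x; rewrite formE.
by apply: (form_ge0 (leq0n n.+1)) => //; exact: cwE.
Qed.
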